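(* Let $\alpha>0$ and let $m\ge0$ be an integer. Let $\tilde z^{(\alpha)}_1<\tilde z^{(\alpha)}_2<\cdots$ be the positive zeros of the Bessel function of the first kind $J_\alpha$, and for each $j\ge1$ let $x_{j,1}<\dots<x_{j,j}$ be the regular zeros of $L^{\mathrm{I}(\alpha)}_{m,m+j}$, i.e. its zeros in $[0,\infty)$. Then for each fixed $i\ge1$, $$\lim_{j\to\infty} j\,x_{j,i}=\frac{\big(\tilde z^{(\alpha)}_i\big)^2}{4}.$$
   Context: For real $\alpha$ and integer $n\ge 0$, $L^{(\alpha)}_n(z)=\sum_{k=0}^n \binom{n+\alpha}{n-k}\frac{(-z)^k}{k!}$ is the classical Laguerre polynomial (generalized binomial coefficients). Put $\xi_{\alpha,m}(z)=L^{(\alpha)}_m(-z)$ and $A^{\mathrm{I}}_{\alpha,m}[y]=\xi_{\alpha,m}\,y'-\xi_{\alpha+1,m}\,y$. The type I exceptional ($X_m$-)Laguerre polynomials are $L^{\mathrm{I}(\alpha)}_{m,m+j}=-A^{\mathrm{I}}_{\alpha-1,m}\big[L^{(\alpha-1)}_j\big]=\xi_{\alpha,m}L^{(\alpha-1)}_j-\xi_{\alpha-1,m}\,\big(L^{(\alpha-1)}_j\big)'$, $j=0,1,2,\dots$. For $\alpha>0$ the polynomial $L^{\mathrm{I}(\alpha)}_{m,m+j}$ has exactly $j$ zeros in $[0,\infty)$, all simple and positive. *)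

(* Defs.v *)
From mathcomp Require Import all_boot all_order all_algebra.
From mathcomp Require Import polyrcf.
From mathcomp Require Import all_classical all_reals all_analysis.

Set Implicit Arguments.
Unset Strict Implicit.
Unset Printing Implicit Defensive.

Import Order.TTheory GRing.Theory Num.Theory.
Import numFieldNormedType.Exports.

Local Open Scope classical_set_scope.
Local Open Scope ring_scope.

(* a (a - 1) ... (a - k + 1) / k!, for real a. *)
Definition gbinomial (R : realType) (a : R) (k : nat) : R :=
  (\prod_(l < k) (a - l%:R)) / (k`!)%:R.

Definition laguerre (R : realType) (alpha : R) (n : nat) : {poly R} :=
  \sum_(k < n.+1)
    (gbinomial (n%:R + alpha) (n - k) / (k`!)%:R) *: (- 'X) ^+ k.

Definition xi_poly (R : realType) (alpha : R) (m : nat) : {poly R} :=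
  laguerre alpha m \Po (- 'X).

Definition opAI (R : realType) (alpha : R) (m : nat) (y : {poly R}) : {poly R} :=
  xi_poly alpha m * y^`() - xi_poly (alpha + 1) m * y.

(* The polynomial L^{I(alpha)}_{m, m+j}: the last argument is j, not m + j. *)
Definition xlaguerreI (R : realType) (alpha : R) (m j : nat) : {poly R} :=
  - opAI (alpha - 1) m (laguerre (alpha - 1) j).

(* The zeros in [0, +oo[, without repetition and in increasing order
   ([rootsR p] is the increasing list of all the real roots of p). *)
Definition regular_zeros (R : realType) (alpha : R) (m j : nat) : seq R :=
  [seq t <- rootsR (xlaguerreI alpha m j) | 0 <= t].

(* Euler's integral; it is only used for s > 0, where it converges. *)
Definition Gamma (R : realType) (s : R) : R :=
  \int[lebesgue_measure]_(t in `]0, +oo[) (t `^ (s - 1) * expR (- t)).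

(* The real Bessel function of the first kind of order alpha, used for
   alpha > 0 and x > 0, where the series converges. *)
Definition besselJ (R : realType) (alpha x : R) : R :=
  limn (series (fun k : nat =>
    (- 1) ^+ k / ((k`!)%:R * Gamma (k%:R + alpha + 1))
      * (x / 2) `^ (2 * k%:R + alpha))).

(* z 0 < z 1 < z 2 < ... are exactly the elements of S. *)
Definition increasing_enumeration (R : realType) (S : set R) (z : nat -> R) :
    Prop :=
  {homo z : i j / (i < j)%N >-> i < j} /\ range z = S.

(* Main.v *)
Require Import Defs.
From mathcomp Require Import all_boot all_order all_algebra.
From mathcomp Require Import polyrcf.
From mathcomp Require Import all_classical all_reals all_analysis.
From mathcomp Require Import measurable_realfun ring lra.

Set Implicit Arguments.
Unset Strict Implicit.
Unset Printing Implicit Defensive.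

Import Order.TTheory GRing.Theory Num.Theory.
Import numFieldNormedType.Exports.

Local Open Scope classical_set_scope.
Local Open Scope ring_scope.

(* Put g(y) = \sum_k (-y)^k / (k! (alpha)_k), so that J_alpha(x) is a nonzero
   multiple of x^alpha g'(x^2 / 4).  After the rescaling x = y / j, the j-th
   polynomial is a nonzero multiple of some F_j, where F_j and F_j' converge
   locally uniformly to -c g' and -c g'', with c = xi_{alpha-1,m}(0) > 0; the
   coefficients of the rescaled Laguerre polynomials differ from those of g by
   a factor 1 + O(k^2 / j).  The positive zeros of g' are simple because
   y g'' + alpha g' + g = 0, and near a simple zero of the limit F_j is
   eventually strictly monotone with a change of sign, hence has exactly one
   zero there, while it has none on compact sets avoiding the zeros of g'.
   Locally uniform convergence to a continuous limit is expressed as joint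
   convergence in (j, y), along [filter_prod \oo (nbhs y)]. *)

(** * Zeros of a converging sequence of polynomials on a segment *)

(** Joint convergence keeps [(F j).[y']] nonzero for all large [j] and all [y'] close to a given
    [y]; compactness of the segment merges these local thresholds on [j] into one. *)
Lemma eventually_no_zero (R : realType) (F : nat -> {poly R}) (f : R -> R)
    (a b : R) :
  (forall y, a <= y <= b ->
    ((fun p : nat * R => (F p.1).[p.2]) @ filter_prod \oo (nbhs y)) --> f y) ->
  (forall y, a <= y <= b -> f y != 0) ->
  \forall j \near \oo, forall y, a <= y <= b -> (F j).[y] != 0.
Proof.
move=> Ff f_neq0.
have key (y : R) : a <= y <= b ->
    \forall y' \near y & j \near \oo, (F j).[y'] != 0.
  move=> yab; have := @cvgr_neq0 R R^o _ _ _ _ (f y) (Ff y yab) (f_neq0 y yab).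
  case=> -[A B] /= [A1 B1] AB.
  by exists (B, A) => // -[u v] /= [Bu Av]; exact: (AB (v, u)).
have /compact_near_coveringP := @segment_compact R a b.
move=> /(_ nat \oo (fun j y => (F j).[y] != 0) _) H.
have {}H : \forall j \near \oo, `[a, b]%classic `<=` (fun y => (F j).[y] != 0).
  by apply: H => y; rewrite /= in_itv /= => yab; exact: key.
by near=> j => y yab; apply: (near H j) => //=; rewrite in_itv.
Unshelve. all: by end_near. Qed.

(** Near [w] the polynomial [F j], multiplied by [f1 w], has slope bounded below, while its value at
    [w] tends to 0; so it changes sign exactly once. The radius [d] stays free below [d0], to be
    shrunk later under the gaps between limit zeros. *)
Lemma eventually_unique_zero (R : realType) (F : nat -> {poly R})
    (f f1 : R -> R) (w : R) :
  ((fun p : nat * R => (F p.1).[p.2]) @ filter_prod \oo (nbhs w)) --> f w ->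
  ((fun p : nat * R => (F p.1)^`().[p.2]) @ filter_prod \oo (nbhs w))
    --> f1 w ->
  f w = 0 -> f1 w != 0 ->
  exists2 d0, 0 < d0 & forall d, 0 < d -> d < d0 -> \forall j \near \oo,
    exists r, w - d < r < w + d /\
      forall x, w - d <= x <= w + d -> root (F j) x = (x == r).
Proof.
move=> Ff Ff1 fw f1w; set l := f1 w in f1w Ff1 *.
have FF : Filter (filter_prod \oo (nbhs w)) by exact: filter_prod_filter.
have l2 : 0 < l ^+ 2 by rewrite exprn_even_gt0.
(* Multiplying by [l] treats both signs of [f1 w] at once. *)
have : \forall p \near filter_prod \oo (nbhs w),
    l ^+ 2 / 2 <= l * (F p.1)^`().[p.2].
  have /(_ (`|l| / 2)) := (@cvgrPdist_le R R^o _ _ FF _ _).1 Ff1.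
  rewrite divr_gt0 ?normr_gt0// => /(_ isT).
  apply: filterS => p /= /(ler_wpM2l (normr_ge0 l)); rewrite -normrM.
  rewrite mulrA -expr2 real_normK ?num_real// mulrBr -expr2 ler_norml.
  by move=> /andP[_]; lra.
case=> -[A B] /= [A1 /nbhs_ballP[d0 /= d0_gt0 B1]] AB.
have {}AB j y : A j -> `|w - y| < d0 ->
    l ^+ 2 / 2 <= l * (F j)^`().[y].
  by move=> Aj yB; apply: (AB (j, y)); split => //; exact: B1.
exists d0 => // d d_gt0 dd0.
(* Over a distance [d] the slope bound moves [l * F j] by at least [l ^+ 2 / 2 * d]; a smaller value
   at [w] therefore forces opposite signs at [w - d] and [w + d]. *)
have small : \forall j \near \oo, `|l * (F j).[w]| < l ^+ 2 / 2 * d.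
  have /(_ (`|l| / 2 * d)) := (@cvgrPdist_lt R R^o _ _ FF _ _).1 Ff.
  rewrite fw mulr_gt0 ?divr_gt0 ?normr_gt0// => /(_ isT).
  case=> -[A' B'] /= [A1' /nbhs_singleton B1'] AB'.
  apply: filterS A1' => j A'j; have /= := AB' (j, w) (conj A'j B1').
  rewrite sub0r normrN -(ltr_pM2l (_ : 0 < `|l|)) ?normr_gt0// -normrM.
  by rewrite !mulrA -expr2 real_normK ?num_real.
near=> j.
have Aj : A j by near: j.
have sj : `|l * (F j).[w]| < l ^+ 2 / 2 * d by near: j.
have right : 0 < l * (F j).[w + d].
  have [|c + E] := @poly_mvt _ w (w + d) (F j); first by rewrite ltrDl.
  rewrite in_itv /= => /andP[c1 c2].
  have := AB j c Aj _; rewrite distrC ger0_norm; last lra.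
  have -> : c - w < d0 by lra.
  move=> /(_ isT) /(ler_wpM2r (ltW d_gt0)).
  have -> : (F j).[w + d] = (F j).[w] + (F j)^`().[c] * d.
    by move: E; rewrite addrAC subrr add0r => <-; ring.
  by move: sj; rewrite ltr_norml => /andP[]; nra.
have left : l * (F j).[w - d] < 0.
  have [|c + E] := @poly_mvt _ (w - d) w (F j); first lra.
  rewrite in_itv /= => /andP[c1 c2].
  have := AB j c Aj _; rewrite ger0_norm; last lra.
  have -> : w - c < d0 by lra.
  move=> /(_ isT) /(ler_wpM2r (ltW d_gt0)).
  have -> : (F j).[w - d] = (F j).[w] - (F j)^`().[c] * d.
    by move: E; rewrite subKr => <-; ring.
  by move: sj; rewrite ltr_norml => /andP[]; nra.
have [||r + r0] := @poly_ivtoo _ (F j) (w - d) (w + d); [lra| |].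
  rewrite -(pmulr_rlt0 _ l2) expr2 mulrACA.
  by rewrite nmulr_rlt0.
rewrite in_itv /= => rw; exists r; split=> // x xw.
apply/idP/eqP => [x0|-> //].
(* By the mean value theorem two zeros would give a zero of the derivative, against the slope
   bound. *)
have noroot a b : a < b -> w - d <= a -> b <= w + d ->
    root (F j) a -> root (F j) b -> False.
  move=> ab wa bw /rootP a0 /rootP b0.
  have [c + E] := @poly_mvt _ _ _ (F j) ab.
  rewrite in_itv /= => /andP[c1 c2].
  move: E; rewrite a0 b0 subrr => /esym/eqP; rewrite mulf_eq0 subr_eq0.
  rewrite (gt_eqF ab) orbF => /eqP c0.
  have := AB j c Aj; rewrite c0 mulr0.
  have -> : `|w - c| < d0 by rewrite ltr_norml; lra.
  by move=> /(_ isT); lra.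
case/andP: xw => xw1 xw2; case/andP: rw => rw1 rw2.
case: (ltgtP x r) => // xr; exfalso.
- by apply: (noroot x r) => //; exact: ltW.
- by apply: (noroot r x) => //; exact: ltW.
Unshelve. all: by end_near. Qed.

(** Used in the induction of [count_zeros]: the counting function jumps by one across each limit
    zero. *)
Lemma count_interval (R : realType) (s : seq R) (a b r : R) : a <= b ->
  uniq s -> (forall x, a <= x < b -> (x \in s) = (x == r)) -> a <= r < b ->
  count (< b) s = (count (< a) s).+1.
Proof.
move=> ab us sr rab.
have rs : r \in s by rewrite sr// eqxx.
have -> : (count (< a) s).+1 = (count (< a) s + count_mem r s)%N.
  by rewrite count_uniq_mem// rs addn1.
rewrite -count_predUI (_ : count (predI _ _) s = 0%N) ?addn0; last first.
  apply/eqP; rewrite -leqn0 leqNgt -has_count; apply/hasPn => x _ /=.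
  by apply/negP => /andP[xa /eqP xr]; move: rab; rewrite -xr leNgt xa.
apply: eq_in_count => x xs /=.
case: (ltP x a) => xa /=; first exact: lt_le_trans ab.
apply/idP/idP => [xb|/eqP ->]; last by case/andP: rab.
by rewrite -sr// xa xb.
Qed.

(** * A real Hurwitz theorem, by counting zeros below a threshold *)

Section real_hurwitz.
Variables (R : realType) (F : nat -> {poly R}) (f f1 : R -> R).
Variables (s : nat -> seq R) (w : nat -> R).
Hypothesis Ff : forall y : R, 0 <= y ->
  ((fun p : nat * R => (F p.1).[p.2]) @ filter_prod \oo (nbhs y)) --> f y.
Hypothesis Ff1 : forall y : R, 0 <= y ->
  ((fun p : nat * R => (F p.1)^`().[p.2]) @ filter_prod \oo (nbhs y)) --> f1 y.
Hypothesis sF : \forall j \near \oo, sorted <%R (s j) /\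
  forall x, (x \in s j) = (0 <= x) && root (F j) x.
Hypothesis w_gt0 : forall k, 0 < w k.
Hypothesis w_mono : {homo w : i j / (i < j)%N >-> i < j}.
Hypothesis f0 : f 0 != 0.
Hypothesis fw : forall k, f (w k) = 0.
Hypothesis f_eq0 : forall y : R, 0 < y -> f y = 0 -> exists k, y = w k.
Hypothesis f1w : forall k, f1 (w k) != 0.

Let f_neq0 (y : R) : 0 <= y -> (forall k, y != w k) -> f y != 0.
Proof.
rewrite le_eqVlt => /orP[/eqP <- //|y_gt0 yw].
by apply/eqP => /(f_eq0 y_gt0)[k yk]; move: (yw k); rewrite yk eqxx.
Qed.

Let count_stable (a b : R) : 0 <= a <= b ->
  (forall y, a <= y <= b -> forall k, y != w k) ->
  \forall j \near \oo, count (< b) (s j) = count (< a) (s j).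
Proof.
move=> /andP[a0 ab] yw.
have H : \forall j \near \oo, forall y, a <= y <= b -> (F j).[y] != 0.
  apply: (@eventually_no_zero _ F f) => y /andP[ay yb].
    by apply: Ff; exact: le_trans ay.
  by apply: f_neq0 => [|k]; [exact: le_trans ay|apply: yw; rewrite ay].
near=> j; have [|ss sE] := near sF j => //.
apply: eq_in_count => x; rewrite sE => /andP[x0 /rootP xr] /=.
case: (ltP x a) => xa; first exact: lt_le_trans ab.
apply/negbTE/negP => xb.
suff : (F j).[x] != 0 by rewrite xr eqxx.
by apply: (near H j) => //; rewrite xa ltW.
Unshelve. all: by end_near. Qed.

(** Induction on [i]: the count is eventually constant between consecutive limit zeros and grows by
    one across [w i]. It starts from 0 because [s j] has no negative element and [f] does not vanish
    at 0. *)
Let count_zeros i (y : R) : 0 <= y -> (forall k, (k < i)%N -> w k < y) ->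
    (forall k, (i <= k)%N -> y < w k) ->
  \forall j \near \oo, count (< y) (s j) = i.
Proof.
elim: i y => [|i IH] y y0 wlty yltw.
  have E : \forall j \near \oo, count (< y) (s j) = count (< 0) (s j).
    apply: count_stable; first by rewrite lexx.
    by move=> x /andP[_ xy] k; rewrite lt_eqF// (le_lt_trans xy)// yltw.
  apply: filterS (filterI sF E) => j [[_ sE] ->].
  apply/eqP; rewrite -leqn0 leqNgt -has_count; apply/hasPn => x /=.
  by rewrite sE => /andP[x0 _]; rewrite -leNgt.
have [d0 d0_gt0 H] := eventually_unique_zero (Ff (ltW (w_gt0 i)))
  (Ff1 (ltW (w_gt0 i))) (fw i) (f1w i).
(* The preceding limit zero, or the endpoint 0 when there is none. *)
pose v := if i is k.+1 then w k else 0.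
have vw : v < w i by rewrite /v; case: (i) => [|k]; rewrite ?w_gt0 ?w_mono.
have v0 : 0 <= v by rewrite /v; case: (i) => // k; exact: ltW.
have wv k : (k < i)%N -> w k <= v.
  rewrite /v; case: (i) => // l; rewrite ltnS leq_eqVlt => /orP[/eqP-> //|].
  by move/w_mono/ltW.
(* With [d = m / 2] the window around [w i] stays within the radius [d0], to the right of [v] and to
   the left of [y]. *)
pose m := Num.min d0 (Num.min (w i - v) (y - w i)).
have m0 : 0 < m by rewrite !lt_min d0_gt0 !subr_gt0 vw wlty.
have [md0 mv my] : [/\ m <= d0, m <= w i - v & m <= y - w i].
  by rewrite !ge_min !lexx !orbT.
pose d := m / 2.
have dm : d < m by rewrite /d; lra.
have d_gt0 : 0 < d by rewrite /d; lra.
have {}H := H d d_gt0 (lt_le_trans dm md0).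
have IHd : \forall j \near \oo, count (< (w i - d)) (s j) = i.
  apply: IH; first lra.
    by move=> k /wv; lra.
  move=> k; rewrite leq_eqVlt => /orP[/eqP <-|/w_mono]; lra.
have stab : \forall j \near \oo,
    count (< y) (s j) = count (< (w i + d)) (s j).
  apply: count_stable; first by apply/andP; split; lra.
  move=> x /andP[x1 x2] k; case: (leqP k i) => [|ik]; last first.
    by rewrite lt_eqF// (le_lt_trans x2)// yltw.
  move=> ki; rewrite gt_eqF//; move: ki.
  by rewrite leq_eqVlt => /orP[/eqP ->|/w_mono]; lra.
apply: filterS (filterI sF (filterI H (filterI IHd stab))).
move=> j [[ss sE] [[r [rw rr]] [ci ->]]].
rewrite (@count_interval _ (s j) (w i - d) (w i + d) r) ?ci//.
- lra.
- exact: lt_sorted_uniq.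
- move=> x /andP[x1 x2]; rewrite sE rr ?x1 ?(ltW x2)//.
  by have -> : 0 <= x by lra.
- by case/andP: rw => /ltW -> ->.
Qed.

(** Exactly [i] zeros lie below [w i - d] and [i.+1] below [w i + d], so the one of index [i] lies
    in between. The second count also shows that the list is long enough for [nth] not to return its
    default. *)
Lemma cvg_nth_zeros i : (fun j => nth 0 (s j) i) @ \oo --> w i.
Proof.
apply/cvgrPdist_le => e e0.
pose v := if i is k.+1 then w k else 0.
have vw : v < w i by rewrite /v; case: (i) => [|k]; rewrite ?w_gt0 ?w_mono.
have v0 : 0 <= v by rewrite /v; case: (i) => // k; exact: ltW.
have wv k : (k < i)%N -> w k <= v.
  rewrite /v; case: (i) => // l; rewrite ltnS leq_eqVlt => /orP[/eqP-> //|].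
  by move/w_mono/ltW.
have wi : w i < w i.+1 by exact: w_mono.
pose m := Num.min e (Num.min (w i - v) (w i.+1 - w i)).
have m0 : 0 < m by rewrite !lt_min e0 !subr_gt0 vw wi.
have [md0 mv my] : [/\ m <= e, m <= w i - v & m <= w i.+1 - w i].
  by rewrite !ge_min !lexx !orbT.
pose d := m / 2.
have dm : d < m by rewrite /d; lra.
have d_gt0 : 0 < d by rewrite /d; lra.
have below : \forall j \near \oo, count (< (w i - d)) (s j) = i.
  apply: count_zeros; first lra.
    by move=> k /wv; lra.
  move=> k; rewrite leq_eqVlt => /orP[/eqP <-|/w_mono]; lra.
have above : \forall j \near \oo, count (< (w i + d)) (s j) = i.+1.
  apply: count_zeros; first lra.
    by move=> k; rewrite ltnS leq_eqVlt => /orP[/eqP->|/w_mono]; lra.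
  move=> k; rewrite leq_eqVlt => /orP[/eqP <-|/w_mono]; lra.
apply: filterS (filterI sF (filterI below above)).
move=> j [[/lt_sorted_is_uniq_le/andP[_ ss] _] [cb ca]].
have lt1 : nth 0 (s j) i < w i + d by apply: nth_count_lt => //; rewrite ca.
have ge1 : w i - d <= nth 0 (s j) i.
  by apply: nth_count_ge => //; rewrite cb leqnn -ca count_size.
by rewrite ler_norml; apply/andP; split; lra.
Qed.

End real_hurwitz.

(** * Power series dominated by an exponential series *)

Definition psum (R : realType) (u : nat -> R) (x : R) : R :=
  limn (pseries u x).

(** Domination by the coefficients of [C * expR (rho * x)]. It makes the series entire and is stable
    under formal differentiation and multiplication by [k], so it carries all the convergence
    arguments. *)
Definition exp_bounded (R : realType) (u : nat -> R) (C rho : R) : Prop :=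
  forall k, `|u k| <= C * (rho ^+ k / k`!%:R).

Section exp_bounded_series.
Variable R : realType.
Implicit Types (u v : nat -> R) (C rho x y : R).

Lemma exp_bounded_ge0 u C rho : exp_bounded u C rho -> 0 <= C.
Proof.
by move=> /(_ 0%N); rewrite expr0 fact0 divr1 mulr1; exact: le_trans.
Qed.

(** The factor [k] is absorbed by [2 ^ k], at the price of doubling [rho]. *)
Lemma exp_bounded_mulrn u C rho : 0 <= rho -> exp_bounded u C rho ->
  exp_bounded (fun k => k%:R * u k) C (2 * rho).
Proof.
move=> rho0 uC k; rewrite normrM normr_nat exprMn -mulrA mulrCA.
rewrite ler_pM// -natrX ler_nat; exact/ltnW/ltn_expl.
Qed.

Lemma exp_bounded_diffs u C rho : exp_bounded u C rho ->
  exp_bounded (pseries_diffs u) (C * rho) rho.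
Proof.
move=> uC k; rewrite /pseries_diffs normrM normr_nat.
apply: le_trans (ler_wpM2l (ler0n _ _) (uC k.+1)) _.
suff -> : k.+1%:R * (C * (rho ^+ k.+1 / (k.+1)`!%:R)) =
  C * rho * (rho ^+ k / k`!%:R) by [].
rewrite exprS factS natrM invfM.
by field; rewrite nat1r !pnatr_eq0 -lt0n fact_gt0.
Qed.

Lemma exp_bounded_term u C rho x k : exp_bounded u C rho ->
  `|u k * x ^+ k| <= (C *: exp_coeff (rho * `|x|)) k.
Proof.
move=> uC; rewrite normrM normrX.
suff -> : (C *: exp_coeff (rho * `|x|)) k =
  C * (rho ^+ k / k`!%:R) * `|x| ^+ k by rewrite ler_wpM2r ?exprn_ge0.
by rewrite -[LHS]/(C * ((rho * `|x|) ^+ k / k`!%:R)) exprMn; ring.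
Qed.

Lemma exp_bounded_cvg u C rho x : 0 <= rho -> exp_bounded u C rho ->
  cvgn [series `|u k * x ^+ k|]_k.
Proof.
move=> rho0 uC.
have ce : cvgn (series (C *: exp_coeff (rho * `|x|))).
  by apply: is_cvg_seriesZ; exact: is_cvg_series_exp_coeff.
apply: (series_le_cvg _ _ _ ce) => [k|k|k]; rewrite ?normr_ge0//=.
  by rewrite mulr_ge0 ?(exp_bounded_ge0 uC) ?exp_coeff_ge0 ?mulr_ge0.
exact: exp_bounded_term.
Qed.

Lemma is_cvg_exp_bounded u C rho x : 0 <= rho -> exp_bounded u C rho ->
  cvgn (pseries u x).
Proof. by move=> rho0 uC; apply: normed_cvg; exact: exp_bounded_cvg uC. Qed.

Lemma ler_norm_psum u C rho x : 0 <= rho -> exp_bounded u C rho ->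
  `|psum u x| <= C * expR (rho * `|x|).
Proof.
move=> rho0 uC; have cu := @exp_bounded_cvg u C rho x rho0 uC.
apply: le_trans (lim_series_norm cu) _.
have ce : cvgn (series (C *: exp_coeff (rho * `|x|))).
  by apply: is_cvg_seriesZ; exact: is_cvg_series_exp_coeff.
rewrite -[C * _]/(C *: _) /expR -lim_seriesZ//; last first.
  exact: is_cvg_series_exp_coeff.
apply: lim_series_le => // k.
exact: exp_bounded_term.
Qed.

Lemma is_derive_psum u C rho x : 0 <= rho -> exp_bounded u C rho ->
  is_derive x (1 : R) (psum u) (psum (pseries_diffs u) x).
Proof.
move=> rho0 uC; apply: (@pseries_snd_diffs _ u (`|x| + 1)).
- exact: is_cvg_exp_bounded uC.
- exact: is_cvg_exp_bounded (exp_bounded_diffs uC).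
- exact: is_cvg_exp_bounded (exp_bounded_diffs (exp_bounded_diffs uC)).
- by rewrite [ltRHS]ger0_norm ?addr_ge0// ltrDl.
Qed.

Lemma psum0 u : psum u 0 = u 0%N.
Proof.
apply/cvg_lim => //; rewrite -cvg_shiftS; apply: cvg_near_cst.
near=> n; rewrite /pseries /series /= big_nat_recl// big1 ?addr0 ?mulr1//.
by move=> k _; rewrite expr0n mulr0.
Unshelve. all: by end_near. Qed.

Lemma psumB u v x : cvgn (pseries u x) -> cvgn (pseries v x) ->
  psum (fun k => u k - v k) x = psum u x - psum v x.
Proof.
move=> cu cv; rewrite /psum -limB//; congr (limn _); apply/funext => n.
rewrite /pseries /series !fctE /= -sumrB.
by apply: eq_bigr => k _; rewrite mulrBl.
Qed.

Lemma horner_psum (p : {poly R}) x : p.[x] = psum (fun k => p`_k) x.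
Proof.
apply/esym/cvg_lim => //; apply: cvg_near_cst.
near=> n; rewrite /pseries /series /= horner_coef.
have pn : (size p <= n)%N by near: n; exists (size p).
rewrite big_mkord (big_ord_widen n (fun i => p`_i * x ^+ i) pn).
rewrite [RHS]big_mkcond /=; apply: eq_bigr => i _; case: ltnP => // pi.
by rewrite nth_default ?mul0r.
Unshelve. all: by end_near. Qed.

Lemma pseries_diffs_deriv (p : {poly R}) :
  pseries_diffs (fun k => p`_k) = (fun k => p^`()`_k).
Proof. by apply/funext => k; rewrite coef_deriv /pseries_diffs mulr_natl. Qed.

Lemma cvg_inv_fst y :
  (fun p : nat * R => p.1%:R^-1) @ filter_prod \oo (nbhs y) --> (0 : R).
Proof.
apply: (@cvg_comp _ _ _ fst (fun j => j%:R^-1) _ \oo); first exact: cvg_fst.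
apply/gtr0_cvgV0; last exact: cvgr_idn.
by near=> j; rewrite ltr0n; near: j; exact: nbhs_infty_gt.
Unshelve. all: by end_near. Qed.

Lemma cvg_psum_joint (u_ : nat -> nat -> R) u v C D rho sigma y :
  0 <= rho -> exp_bounded u C rho ->
  0 <= sigma -> exp_bounded v D sigma ->
  (forall j k, (0 < j)%N -> `|u_ j k - u k| <= v k / j%:R) ->
  (fun p : nat * R => psum (u_ p.1) p.2) @ filter_prod \oo (nbhs y) -->
    psum u y.
Proof.
move=> rho0 uC sigma0 vD uv.
have FF : Filter (filter_prod \oo (nbhs y)) by exact: filter_prod_filter.
have pos (j : nat) : (0 < j)%N -> 0 < (j%:R : R)^-1 by rewrite invr_gt0 ltr0n.
have db j : (0 < j)%N -> exp_bounded (fun k => u_ j k - u k) (D / j%:R) sigma.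
  move=> j0 k; apply: le_trans (uv j k j0) _.
  rewrite mulrAC ler_wpM2r ?(ltW (pos _ j0))//.
  by apply: le_trans (vD k); exact: ler_norm.
have duv j x : (0 < j)%N ->
    `|psum (u_ j) x - psum u x| <= D * expR (sigma * `|x|) / j%:R.
  move=> j0; rewrite -psumB.
  - by apply: le_trans (ler_norm_psum x sigma0 (db j j0)) _; rewrite mulrAC.
  - have -> : u_ j = fun k => (u_ j k - u k) + u k.
      by apply/funext => k; rewrite subrK.
    have -> : pseries (fun k => u_ j k - u k + u k) x =
      pseries (fun k => u_ j k - u k) x \+ pseries u x.
      apply/funext => n; rewrite /pseries /series /= -big_split /=.
      by apply: eq_bigr => k _; rewrite mulrDl.
    apply: is_cvgD; [exact: is_cvg_exp_bounded (db j j0)|].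
    exact: is_cvg_exp_bounded uC.
  - exact: is_cvg_exp_bounded uC.
have cu : {for y, continuous (psum u)}.
  apply/differentiable_continuous/derivable1_diffP.
  by have [] := is_derive_psum y rho0 uC.
have -> : (fun p : nat * R => psum (u_ p.1) p.2) =
    (fun p => psum u p.2 + (psum (u_ p.1) p.2 - psum u p.2)).
  by apply/funext => p; rewrite addrC subrK.
rewrite -[X in _ --> X]addr0; apply: cvgD.
  apply: (@cvg_comp _ _ _ snd (psum u) _ (nbhs y)); [exact: cvg_snd|exact: cu].
pose K := D * expR (sigma * (`|y| + 1)).
have invj :
  (fun p : nat * R => K / p.1%:R) @ filter_prod \oo (nbhs y) --> (0 : R).
  rewrite -[X in _ --> X](mulr0 K); apply: cvgM; first exact: cvg_cst.
  exact: cvg_inv_fst.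
apply/norm_cvg0P/(@squeeze_cvgr _ _ _ _ (cst 0) (fun p => K / p.1%:R)) => //.
  exists ([set j | (0 < j)%N], [set x | `|y - x| < 1]) => /=.
    split; first by exists 1%N.
    by exists 1 => /=.
  move=> [j x] /= [j0 yx]; rewrite normr_ge0 /=.
  apply: le_trans (duv j x j0) _; rewrite ler_wpM2r ?(ltW (pos _ j0))//.
  rewrite ler_wpM2l ?(exp_bounded_ge0 vD)// ler_expR ler_wpM2l//.
  rewrite -lerBlDl; apply: le_trans (ltW yx).
  by rewrite distrC lerB_dist.
exact: cvg_cst.
Unshelve. all: by end_near. Qed.

End exp_bounded_series.

(* [psum (bessel_coef alpha)] at [x ^+ 2 / 4] is, up to a nonzero factor,
   x^(1 - alpha) J_(alpha - 1)(x). *)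
Definition bessel_coef (R : realType) (alpha : R) (k : nat) : R :=
  (-1) ^+ k / (k`!%:R * \prod_(l < k) (alpha + l%:R)).

Section bessel_clifford.
Variables (R : realType) (alpha : R).
Hypothesis alpha_gt0 : 0 < alpha.
Local Notation b := (bessel_coef alpha).
Local Notation g := (psum b).
Local Notation g1 := (psum (pseries_diffs b)).
Local Notation g2 := (psum (pseries_diffs (pseries_diffs b))).

Lemma rising_gt0 k : 0 < \prod_(l < k) (alpha + l%:R).
Proof. by apply: prodr_gt0 => l _; rewrite ltr_pwDl. Qed.

Lemma bessel_coefS k :
  k.+1%:R * (k%:R + alpha) * b k.+1 = - b k.
Proof.
rewrite /bessel_coef big_ord_recr /= factS natrM exprS.
have := rising_gt0 k; set P := \prod_(l < k) _ => P0.
have ak : 0 < alpha + k%:R by rewrite ltr_pwDl.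
field; rewrite nat1r !pnatr_eq0 -lt0n fact_gt0 /=.
by rewrite andbT (gt_eqF P0) (gt_eqF ak).
Qed.

Lemma exp_bounded_bessel : exp_bounded b (1 + alpha^-1) 1.
Proof.
have ia : 0 < alpha^-1 by rewrite invr_gt0.
have H k : (\prod_(l < k) (alpha + l%:R))^-1 <= 1 + alpha^-1.
  elim: k => [|[|k] IH]; rewrite ?big_ord0 ?invr1 ?lerDl ?(ltW ia)//.
    by rewrite big_ord1 addr0 lerDr.
  rewrite big_ord_recr /= invfM; apply: le_trans IH.
  rewrite ler_piMr ?invr_ge0 ?(ltW (rising_gt0 _))// invf_le1.
    by rewrite -nat1r addrCA lerDl addr_ge0 ?ler0n ?ltW.
  by rewrite ltr_pwDl.
move=> k; rewrite expr1n normrM normrX normrN1 expr1n !mul1r normfV.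
rewrite gtr0_norm ?mulr_gt0 ?rising_gt0 ?ltr0n ?fact_gt0// invfM mulrC.
by rewrite ler_wpM2r ?invr_ge0 ?ler0n.
Qed.

Lemma bessel_ode y : y * g2 y + alpha * g1 y + g y = 0.
Proof.
have Hb := exp_bounded_bessel; have Hb1 := exp_bounded_diffs Hb.
have Hb2 := exp_bounded_diffs Hb1.
pose S u n := pseries u y n.
have E n : y * S (pseries_diffs (pseries_diffs b)) n +
    alpha * S (pseries_diffs b) n.+1 + S b n.+1 = 0.
  transitivity (alpha * pseries_diffs b 0 + b 0%N + \sum_(0 <= k < n)
      (y * (pseries_diffs (pseries_diffs b) k * y ^+ k) +
       alpha * (pseries_diffs b k.+1 * y ^+ k.+1) + b k.+1 * y ^+ k.+1)).
    rewrite /S /pseries /series /= !big_nat_recl// !big_split /= -!mulr_sumr.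
    by ring.
  have := bessel_coefS 0; rewrite mulr0n add0r mul1r => b1.
  rewrite big1 => [|k _].
    by rewrite /pseries_diffs mul1r b1 addNr addr0.
  rewrite /pseries_diffs exprS; have := bessel_coefS k.+1.
  move: (b k.+2) (b k.+1) => B C /eqP; rewrite -subr_eq0 opprK => /eqP BC.
  by rewrite -[RHS](mulr0 (y * y ^+ k)) -BC; ring.
have cvS u C : exp_bounded u C 1 -> S u @ \oo --> psum u y.
  by move=> uC; exact: is_cvg_exp_bounded uC.
have c1 : S (pseries_diffs b) n.+1 @[n --> \oo] --> g1 y.
  by have := cvS _ _ Hb1; rewrite -cvg_shiftS.
have c0 : S b n.+1 @[n --> \oo] --> g y.
  by have := cvS _ _ Hb; rewrite -cvg_shiftS.
have : (fun n => y * S (pseries_diffs (pseries_diffs b)) n +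
    alpha * S (pseries_diffs b) n.+1 + S b n.+1) @ \oo -->
    y * g2 y + alpha * g1 y + g y.
  apply: cvgD => //; apply: cvgD; apply: cvgM => //; try exact: cvg_cst.
  exact: cvS Hb2.
rewrite (_ : (fun _ => _) = cst 0) => [c|]; last exact/funext.
by rewrite -(cvg_lim _ c)// lim_cst.
Qed.

Lemma bessel_simple_zero y : 0 < y -> g1 y = 0 -> g2 y != 0.
Proof.
move=> y0 g1y; apply/eqP => g2y.
have gy : g y = 0.
  by have := bessel_ode y; rewrite g1y g2y !mulr0 !add0r.
have Hb := exp_bounded_bessel; have Hb1 := exp_bounded_diffs Hb.
have dg x : is_derive x (1 : R) g (g1 x) by exact: is_derive_psum Hb.
have dg1 x : is_derive x (1 : R) g1 (g2 x) by exact: is_derive_psum Hb1.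
pose M := (Num.bound (2 * alpha)).
have Ma : 2 * alpha <= M%:R.
  by apply/ltW/archi_boundP; rewrite mulr_ge0 ?ltW.
have Mb : 0 <= M%:R + 2 - 2 * alpha.
  by rewrite subr_ge0; apply: le_trans Ma _; rewrite lerDl.
(* The energy x g'^2 + g^2 need not increase, but x^(M + 1) times it does. *)
pose H : R -> R := id ^+ M.+1 * (id * g1 ^+ 2 + g ^+ 2).
have HE x : H x = x ^+ M.+1 * (x * g1 x ^+ 2 + g x ^+ 2) by rewrite /H !fctE.
have dH x : is_derive x (1 : R) H
    (x ^+ M * ((M%:R + 2 - 2 * alpha) * x * g1 x ^+ 2 + M.+1%:R * g x ^+ 2)).
  rewrite /H; apply: is_derive_eq; rewrite /GRing.scale /= !fctE.
  have -> : g x = - (x * g2 x + alpha * g1 x).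
    by have /eqP := bessel_ode x; rewrite addrC addr_eq0 => /eqP.
  by move: (g1 x) (g2 x) => p q; rewrite !expr1 mulr1 !exprS; ring.
have Hx x : 0 < x -> x < y -> g x = 0.
  move=> x0 xy.
  have [|c] := @MVT _ H _ x y xy (fun z _ => dH z).
    by apply: derivable_within_continuous => z _; have [] := dH z.
  rewrite in_itv /= => /andP[xc cy] E.
  have c0 : 0 < c := lt_trans x0 xc.
  have Hy : H y = 0 by rewrite HE g1y gy !expr0n /= !mulr0 addr0 mulr0.
  have : H x <= 0.
    rewrite -Hy -subr_ge0 E mulr_ge0 ?subr_ge0 ?(ltW xy)//.
    rewrite mulr_ge0 ?exprn_ge0 ?(ltW c0)// addr_ge0//.
      by rewrite mulr_ge0 ?sqr_ge0// mulr_ge0// ltW.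
    by rewrite mulr_ge0 ?sqr_ge0.
  rewrite HE pmulr_rle0 ?exprn_gt0// => Ex.
  apply/eqP; rewrite -sqrf_eq0 eq_le sqr_ge0 andbT.
  by apply: le_trans Ex; rewrite lerDr mulr_ge0 ?sqr_ge0 ?ltW.
have cg : g @ (0 : R) --> (1 : R).
  have -> : 1 = g 0 by rewrite psum0 /bessel_coef big_ord0 fact0 mulr1 divr1.
  by apply/differentiable_continuous/derivable1_diffP; have [] := dg 0.
have /cvgrPdist_lt /(_ 1 ltr01)[d /= d0 Hd] := cg.
pose x := Num.min d y / 2.
have m0 : 0 < Num.min d y by rewrite lt_min d0 y0.
have [md my] : Num.min d y <= d /\ Num.min d y <= y.
  by rewrite !ge_min !lexx orbT.
have x0 : 0 < x by rewrite /x; lra.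
have xy : x < y by rewrite /x; lra.
have : `|1 - g x| < 1.
  by apply: Hd; rewrite /= sub0r normrN gtr0_norm// /x; lra.
by rewrite Hx// subr0 normr1 ltxx.
Qed.

End bessel_clifford.

Section gamma.
Variable R : realType.
Notation mu := (@lebesgue_measure R).
Implicit Types (s p t : R).

Let integrand s t : R := t `^ (s - 1) * expR (- t).
Let majorant (C t : R) : R := C * expR (- (t / 2)).

Let integrand_le s : 1 < s ->
  exists2 C, 0 < C & forall t, 0 <= t -> integrand s t <= majorant C t.
Proof.
move=> s1; pose p := s - 1; have p0 : 0 < p by rewrite subr_gt0.
pose N := (Num.bound p).
have pN : p <= N.+1%:R.
  by apply: le_trans (ltW (archi_boundP (ltW p0))) _; rewrite ler_nat.
pose C : R := 2 ^+ N.+1 * N.+1`!%:R.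
have C1 : 1 <= C.
  by rewrite /C -natrX -natrM ler1n muln_gt0 expn_gt0 fact_gt0.
exists C => [|t t0]; first exact: lt_le_trans C1.
suff H : t `^ p <= C * expR (t / 2).
  rewrite /integrand /majorant.
  have -> : - (t / 2) = t / 2 - t by field.
  by rewrite expRD mulrA ler_wpM2r ?expR_ge0.
have t20 : 0 <= t / 2 by rewrite divr_ge0.
have tN : t `^ p <= 1 + t ^+ N.+1.
  have [t1|t1] := leP t 1.
    apply: (@le_trans _ _ (1 `^ p)); last by rewrite powR1 lerDl exprn_ge0.
    by apply: ge0_ler_powR; rewrite ?nnegrE// ltW.
  rewrite -powR_mulrn//; apply: le_trans (ler_powR (ltW t1) pN) _.
  by rewrite lerDr.
apply: le_trans tN _; apply: le_trans (ler_wpM2l _ (expR_ge1Dxn N t20)).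
  rewrite mulrDr mulr1 lerD// /C exprMn exprVn.
  rewrite le_eqVlt; apply/orP; left; apply/eqP.
  by field; rewrite expf_neq0// pnatr_eq0 -lt0n fact_gt0.
exact: le_trans C1.
Qed.

Let measurable_integrand s (D : set R) : measurable D ->
  measurable_fun D (integrand s).
Proof.
move=> mD; apply/measurable_funTS; apply: measurable_funM.
  exact: measurable_powR.
by apply: measurableT_comp => //; exact: measurable_expR.
Qed.

Let measurable_majorant C (D : set R) : measurable D ->
  measurable_fun D (majorant C).
Proof.
move=> mD; apply/measurable_funTS; apply: measurable_funM => //.
apply: measurableT_comp; first exact: measurable_expR.
apply: measurableT_comp => //; exact: measurable_funM.
Qed.

Let majorant_cvg0 C : majorant C t @[t --> +oo] --> 0.
Proof.
rewrite -[X in _ --> X](mulr0 C); apply: cvgM; first exact: cvg_cst.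
apply: (@cvg_comp _ _ _ (fun t : R => t / 2) (fun t => expR (- t)) _ +oo).
  apply: gt0_cvgMly => //; exact: cvg_id.
exact: cvgr_expR.
Qed.

Let is_derive_majorant C t :
  is_derive t (1 : R) (majorant C) (- (C / 2 * expR (- (t / 2)))).
Proof.
have -> : majorant C = C *: (expR \o (- 2^-1 *: id)).
  by apply/funext => x; rewrite /majorant !fctE [x / 2]mulrC -mulNr.
apply: is_derive_eq; rewrite !fctE /GRing.scale /= mulr1 mulNr [t / 2]mulrC.
by ring.
Qed.

Let integral_majorant C : 0 <= C ->
  (\int[mu]_(t in `[0%R, +oo[) (majorant C t)%:E = (2 * C)%:E)%E.
Proof.
move=> C0.
rewrite (@ge0_continuous_FTC2y _ _ (fun t => majorant (- 2 * C) t) _ 0).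
- by rewrite -EFinB /majorant mul0r oppr0 expR0 mulr1 sub0r mulNr opprK.
- by move=> t _; rewrite mulr_ge0 ?expR_ge0.
- apply: continuous_subspaceT => t.
  apply/differentiable_continuous/derivable1_diffP.
  by have [] := is_derive_majorant C t.
- exact: majorant_cvg0.
- by move=> t _; have [] := is_derive_majorant (- 2 * C) t.
- apply: cvg_at_right_filter.
  apply/differentiable_continuous/derivable1_diffP.
  by have [] := is_derive_majorant (- 2 * C) 0.
- move=> t _; rewrite derive1E; have [_ ->] := is_derive_majorant (- 2 * C) t.
  by rewrite /majorant; field.
Qed.

Let E s := (\int[mu]_(t in `[0%R, +oo[) (integrand s t)%:E)%E.

Let integrand_ge0 s t : 0 <= integrand s t.
Proof. by rewrite mulr_ge0 ?powR_ge0 ?expR_ge0. Qed.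

Let integrand0 s : 1 < s -> integrand s 0 = 0.
Proof. by move=> s1; rewrite /integrand powR0 ?mul0r// subr_eq0 gt_eqF. Qed.

Let integrand_cvg0 s : 1 < s -> integrand s t @[t --> 0^'+] --> integrand s 0.
Proof.
move=> s1; rewrite integrand0// -[X in _ --> X](mul0r (expR (- 0))).
apply: cvgM; first by apply: powR_cvg0; rewrite subr_gt0.
apply: cvg_at_right_filter.
have := @continuous_comp R R R -%R expR 0; apply.
  exact: opp_continuous.
exact: continuous_expR.
Qed.

Let is_derive_integrand s t : 0 < t ->
  is_derive t (1 : R) (integrand s)
    ((s - 1) * integrand (s - 1) t - integrand s t).
Proof.
move=> t0.
have := is_derive1_powR (s - 1) t0 => dp.
have -> : integrand s = (@powR R)^~ (s - 1) * (expR \o (- id)).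
  by apply/funext => x; rewrite !fctE.
apply: is_derive_eq; rewrite /GRing.scale !fctE /integrand /=.
by ring.
Qed.

Let integrandS_cvg0 s : 1 < s -> integrand s t @[t --> +oo] --> 0.
Proof.
move=> s1; have [C C0 le_maj] := integrand_le s1.
apply: (@squeeze_cvgr _ _ _ _ (cst 0) (majorant C)); last 2 first.
- exact: cvg_cst.
- exact: majorant_cvg0.
near=> t; rewrite integrand_ge0/=; apply: le_maj.
by near: t; apply: nbhs_pinfty_ge; exact: num_real.
Unshelve. all: by end_near. Qed.

Let E_rec s : 1 < s -> E (s + 1) = (s%:E * E s)%E.
Proof.
move=> s1; have s0 : 0 < s by exact: lt_trans s1.
have s11 : 1 < s + 1 by rewrite ltrDr.
have [D D0 le_D] := integrand_le s1; pose C := s * D.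
have C0 : 0 <= C by rewrite mulr_ge0 ?ltW.
have le_maj t : 0 <= t -> s * integrand s t <= majorant C t.
  by move=> t0; rewrite /majorant /C -mulrA ler_pM2l// le_D.
pose f t := integrand (s + 1) t - s * integrand s t + majorant C t.
pose F t := - integrand (s + 1) t + majorant (- 2 * C) t.
have dF t : 0 < t -> is_derive t (1 : R) F (f t).
  move=> t0; have d1 := is_derive_integrand (s + 1) t0.
  have d2 := is_derive_majorant (- 2 * C) t.
  apply: is_derive_eq; rewrite addrK /f /majorant. by field.
have If : (\int[mu]_(t in `[0%R, +oo[) (f t)%:E = (2 * C)%:E)%E.
  rewrite (@ge0_continuous_FTC2y _ _ F _ 0).
  - rewrite -EFinB /F integrand0// /majorant mul0r !oppr0 expR0 mulr1.
    by rewrite sub0r add0r mulNr opprK.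
  - move=> t t0; rewrite /f -addrA addr_ge0 ?integrand_ge0//.
    by rewrite addrC subr_ge0 le_maj.
  - have cM x : {for x, continuous (majorant C)}.
      apply/differentiable_continuous/derivable1_diffP.
      by have [] := is_derive_majorant C x.
    have ci u x : 0 < x -> {for x, continuous (integrand u)}.
      move=> x0; apply/differentiable_continuous/derivable1_diffP.
      by have [] := is_derive_integrand u x0.
    apply/continuous_within_itvcyP; split.
      move=> x; rewrite in_itv /= andbT => x0.
      apply: cvgD; last exact: cM.
      by apply: cvgB; [exact: ci|apply: cvgM; [exact: cvg_cst|exact: ci]].
    apply: cvgD; last exact: cvg_at_right_filter (cM 0).
    apply: cvgB; first exact: integrand_cvg0.
    by apply: cvgM; [exact: cvg_cst|exact: integrand_cvg0].
  - rewrite -[X in _ --> X]addr0; apply: cvgD; last exact: majorant_cvg0.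
    by rewrite -[X in _ --> X]oppr0; apply: cvgN; exact: integrandS_cvg0.
  - by move=> t /dF[].
  - apply: cvgD; first by apply: cvgN; exact: integrand_cvg0.
    apply: cvg_at_right_filter.
    apply/differentiable_continuous/derivable1_diffP.
    by have [] := is_derive_majorant (- 2 * C) 0.
  - by move=> t; rewrite in_itv /= andbT derive1E => /dF[].
have f_ge0 t : 0 <= t -> 0 <= f t.
  move=> t0; rewrite /f -addrA addr_ge0 ?integrand_ge0//.
  by rewrite addrC subr_ge0 le_maj.
have mI : measurable (`[0%R, +oo[%classic : set R) by [].
have ms : measurable_fun (`[0%R, +oo[%classic : set R)
    (fun t => s * integrand s t).
  by apply: measurable_funM => //; exact: measurable_integrand.
have mf : measurable_fun (`[0%R, +oo[%classic : set R) f.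
  apply: measurable_funD; last exact: measurable_majorant.
  by apply: measurable_funB => //; exact: measurable_integrand.
have Is : (\int[mu]_(t in `[0%R, +oo[) (s * integrand s t)%:E = s%:E * E s)%E.
  under eq_integral do rewrite EFinM.
  rewrite ge0_integralZl_EFin//.
  - by move=> t _; rewrite lee_fin.
  - by apply/measurable_EFinP; exact: measurable_integrand.
  - exact: ltW.
have sum1 : (\int[mu]_(t in `[0%R, +oo[) ((f t)%:E + (s * integrand s t)%:E) =
    (2 * C)%:E + s%:E * E s)%E.
  rewrite ge0_integralD ?If ?Is//.
  - by move=> t; rewrite /= in_itv /= andbT lee_fin => /f_ge0.
  - exact/measurable_EFinP.
  - by move=> t _; rewrite lee_fin mulr_ge0 ?(ltW s0).
  - exact/measurable_EFinP.
have sum2 : (\int[mu]_(t in `[0%R, +oo[) ((f t)%:E + (s * integrand s t)%:E) =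
    (2 * C)%:E + E (s + 1))%E.
  rewrite -(integral_majorant C0) -ge0_integralD//.
  - apply: eq_integral => t _; rewrite -!EFinD /f; congr EFin; ring.
  - by move=> t _; rewrite lee_fin mulr_ge0 ?expR_ge0.
  - by apply/measurable_EFinP; exact: measurable_majorant.
  - by move=> t _; rewrite lee_fin.
  - by apply/measurable_EFinP; exact: measurable_integrand.
have := etrans (esym sum2) sum1; move: (E _) (s%:E * _)%E.
by move=> [x||] [y||] //= [/addrI ->].
Qed.

Let Gamma_E s : Gamma s = fine (E s).
Proof.
rewrite /Gamma /Rintegral; congr fine; apply: integral_itv_obnd_cbnd.
by apply/measurable_EFinP; exact: measurable_integrand.
Qed.

Lemma GammaS s : 1 < s -> Gamma (s + 1) = s * Gamma s.
Proof.
move=> s1; have s0 : 0 < s by exact: lt_trans s1.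
rewrite !Gamma_E E_rec//; case: (E s) => [r||] //=; rewrite mulr0.
  by rewrite gt0_muley ?lte_fin.
by rewrite gt0_muleNy ?lte_fin.
Qed.

Lemma Gamma_gt0 s : 1 < s -> 0 < Gamma s.
Proof.
move=> s1; rewrite Gamma_E.
have [C C0 le_C] := integrand_le s1.
have mI : measurable (`[0%R, +oo[%classic : set R) by [].
apply: fine_gt0; apply/andP; split; last first.
  apply: (@le_lt_trans _ _ (2 * C)%:E); last exact: ltry.
  rewrite -(integral_majorant (ltW C0)); apply: ge0_le_integral => //.
  - by move=> t _; rewrite lee_fin.
  - by apply/measurable_EFinP; exact: measurable_integrand.
  - by apply/measurable_EFinP; exact: measurable_majorant.
  - by move=> t; rewrite /= in_itv /= andbT lee_fin => /le_C.
apply: (@lt_le_trans _ _ (expR (- 2))%:E); first by rewrite lte_fin expR_gt0.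
apply: (@le_trans _ _ (\int[mu]_(t in `[1%R, 2%R]) (integrand s t)%:E)%E).
  apply: (@le_trans _ _ (\int[mu]_(t in `[1%R, 2%R]) (expR (- 2))%:E)%E).
    rewrite integral_cst//= lebesgue_measure_itv /= lte_fin ltr1n.
    by rewrite -EFinB -EFinM lee_fin (_ : 2 - 1 = 1) ?mulr1//; ring.
  apply: ge0_le_integral => //.
  - by apply/measurable_EFinP; exact: measurable_integrand.
  - move=> t; rewrite /= in_itv /= lee_fin => /andP[t1 t2].
    rewrite -[leLHS]mul1r ler_pM ?expR_ge0//.
      apply: (@le_trans _ _ (1 `^ (s - 1))); first by rewrite powR1.
      apply: ge0_ler_powR; rewrite ?nnegrE ?subr_ge0 ?(ltW s1)//.
      exact: le_trans t1.
    by rewrite ler_expR lerN2.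
apply: ge0_subset_integral => //.
- by apply/measurable_EFinP; exact: measurable_integrand.
- by move=> t _; rewrite lee_fin.
- move=> t; rewrite /= !in_itv /= andbT => /andP[t1 _].
  exact: le_trans t1.
Qed.
End gamma.

Lemma le_dist_ffact_exp (R : realType) (j k : nat) : (0 < j)%N ->
  `|(j ^_ k)%:R / j%:R ^+ k - 1| <= k%:R * k%:R / j%:R :> R.
Proof.
move=> j0; have jR : 0 < j%:R :> R by rewrite ltr0n.
have c1 n : (j ^_ n)%:R / j%:R ^+ n <= 1 :> R.
  rewrite ler_pdivrMr ?exprn_gt0// mul1r -natrX ler_nat.
  by elim: n => // n IH; rewrite ffactnSr expnSr leq_mul ?leq_subr.
rewrite distrC ger0_norm ?subr_ge0//.
elim: k => [|k IH]; first by rewrite expr0 divr1 subrr !mul0r.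
rewrite ffactnSr natrM exprSr.
have [kj|jk] := leqP k j; last first.
  have -> : (j - k = 0)%N by apply/eqP; rewrite subn_eq0 ltnW.
  rewrite mulr0 mul0r subr0 ler_pdivlMr// mul1r -natrM ler_nat.
  by rewrite (leq_trans (ltnW (leqW jk)))// leq_pmulr.
rewrite natrB//; have := c1 k; move: IH.
set c := _ / _ => IH c1k.
have -> : (j ^_ k)%:R * (j%:R - k%:R) / (j%:R ^+ k * j%:R) =
    c * (1 - k%:R / j%:R) :> R.
  by rewrite /c; field; rewrite expf_neq0 gt_eqF.
have kj0 : 0 <= k%:R / j%:R :> R by rewrite divr_ge0.
have ij0 : 0 <= j%:R^-1 :> R by rewrite invr_ge0 ltW.
have ck : c * (k%:R / j%:R) <= k%:R / j%:R by rewrite ler_piMl.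
rewrite -nat1r (_ : (1 + k%:R) * (1 + k%:R) / j%:R =
  k%:R * k%:R / j%:R + k%:R / j%:R + (k%:R / j%:R + j%:R^-1)) ?lerDl; last ring.
apply: le_trans (_ : k%:R * k%:R / j%:R + k%:R / j%:R <= _); last first.
  by rewrite lerDl addr_ge0.
by rewrite mulrBr mulr1 opprB addrCA addrC lerD.
Qed.

Definition scaled_laguerre (R : realType) (alpha : R) (j : nat) : {poly R} :=
  \poly_(k < j.+1) ((j ^_ k)%:R / j%:R ^+ k * bessel_coef alpha k).

Section scaled_laguerre.
Variables (R : realType) (alpha : R).
Hypothesis alpha_gt0 : 0 < alpha.
Local Notation b := (bessel_coef alpha).

Lemma gbinomial_rising (j k : nat) : (k <= j)%N ->
  gbinomial (j%:R + (alpha - 1)) (j - k) =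
    (\prod_(k <= i < j) (alpha + i%:R)) / (j - k)`!%:R.
Proof.
move=> kj; rewrite /gbinomial big_rev_mkord; congr (_ / _).
apply: eq_bigr => i _; rewrite natrB; last first.
  by apply: leq_trans (ltn_ord i) (leq_subr _ _).
by rewrite -nat1r; ring.
Qed.

Lemma laguerre_scaled (j : nat) : (0 < j)%N ->
  laguerre (alpha - 1) j \Po (j%:R^-1 *: 'X) =
    gbinomial (j%:R + (alpha - 1)) j *: scaled_laguerre alpha j.
Proof.
move=> j0; rewrite /laguerre raddf_sum /scaled_laguerre poly_def scaler_sumr.
apply: eq_bigr => -[k /= kj] _; rewrite ltnS in kj.
rewrite comp_polyZ rmorphXn rmorphN /= comp_polyX -scaleNr exprZn !scalerA.
congr (_ *: _); rewrite gbinomial_rising//.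
have := @gbinomial_rising j 0 isT; rewrite subn0 => ->.
have -> : \prod_(0 <= i < j) (alpha + i%:R) =
    \prod_(l < k) (alpha + l%:R) * \prod_(k <= i < j) (alpha + i%:R).
  by rewrite (big_cat_nat (leq0n k) kj) big_mkord.
rewrite /bessel_coef -(ffact_fact kj) natrM.
have P0 := rising_gt0 alpha_gt0 k.
have jR : j%:R != 0 :> R by rewrite pnatr_eq0 -lt0n.
have f1 : (j - k)`!%:R != 0 :> R by rewrite pnatr_eq0 -lt0n fact_gt0.
have f2 : k`!%:R != 0 :> R by rewrite pnatr_eq0 -lt0n fact_gt0.
have f3 : (j ^_ k)%:R != 0 :> R by rewrite pnatr_eq0 -lt0n ffact_gt0.
rewrite [(- _^-1) ^+ k]exprNn exprVn; move: (\prod_(l < k) _) P0 => P P0.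
by field; rewrite f1 f2 f3 (gt_eqF P0) expf_neq0.
Qed.

Lemma coef_scaled_laguerre j k :
  (scaled_laguerre alpha j)`_k = (j ^_ k)%:R / j%:R ^+ k * b k.
Proof.
rewrite coef_poly; case: ltnP => // jk.
by rewrite ffact_small// !mul0r.
Qed.

Let v k := k%:R * (k%:R * `|b k|).

Let vC : exp_bounded v (1 + alpha^-1) (2 * (2 * 1)).
Proof.
apply: exp_bounded_mulrn => //; apply: exp_bounded_mulrn => // k.
by rewrite normr_id; exact: exp_bounded_bessel.
Qed.

Let le_coef j k : (0 < j)%N ->
  `|(scaled_laguerre alpha j)`_k - b k| <= v k / j%:R.
Proof.
move=> j0; rewrite coef_scaled_laguerre -[X in _ - X]mul1r -mulrBl normrM.
apply: le_trans (ler_wpM2r (normr_ge0 _) (le_dist_ffact_exp R k j0)) _.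
by rewrite le_eqVlt /v; apply/orP; left; apply/eqP; ring.
Qed.

Let le_diffs (u_ : nat -> nat -> R) (u w : nat -> R) :
  (forall j k, (0 < j)%N -> `|u_ j k - u k| <= w k / j%:R) ->
  forall j k, (0 < j)%N ->
  `|pseries_diffs (u_ j) k - pseries_diffs u k| <= pseries_diffs w k / j%:R.
Proof.
move=> uw j k j0; rewrite /pseries_diffs -mulrBr normrM normr_nat -mulrA.
by rewrite ler_wpM2l// uw.
Qed.

Lemma cvg_scaled_laguerre (y : R) :
  [/\ (fun p : nat * R => (scaled_laguerre alpha p.1).[p.2])
        @ filter_prod \oo (nbhs y) --> psum b y,
      (fun p : nat * R => (scaled_laguerre alpha p.1)^`().[p.2])
        @ filter_prod \oo (nbhs y) --> psum (pseries_diffs b) y &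
      (fun p : nat * R => (scaled_laguerre alpha p.1)^`()^`().[p.2])
        @ filter_prod \oo (nbhs y) -->
          psum (pseries_diffs (pseries_diffs b)) y].
Proof.
have Hb := exp_bounded_bessel alpha_gt0; have Hb1 := exp_bounded_diffs Hb.
have Hb2 := exp_bounded_diffs Hb1.
have vC1 := exp_bounded_diffs vC; have vC2 := exp_bounded_diffs vC1.
have le1 := le_diffs le_coef; have le2 := le_diffs le1.
have two : 0 <= 2 * (2 * 1) :> R by rewrite !mulr_ge0.
have hornerE1 : (fun p : nat * R => (scaled_laguerre alpha p.1)^`().[p.2]) =
  fun p => psum (pseries_diffs (fun k => (scaled_laguerre alpha p.1)`_k)) p.2.
  by apply/funext => p; rewrite horner_psum pseries_diffs_deriv.
have hornerE2 : (fun p : nat * R => (scaled_laguerre alpha p.1)^`()^`().[p.2]) =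
  fun p => psum (pseries_diffs (pseries_diffs
    (fun k => (scaled_laguerre alpha p.1)`_k))) p.2.
  by apply/funext => p; rewrite horner_psum -!pseries_diffs_deriv.
have hornerE0 : (fun p : nat * R => (scaled_laguerre alpha p.1).[p.2]) =
  fun p => psum (fun k => (scaled_laguerre alpha p.1)`_k) p.2.
  by apply/funext => p; rewrite horner_psum.
split; rewrite ?hornerE0 ?hornerE1 ?hornerE2.
- exact: cvg_psum_joint ler01 Hb two vC le_coef.
- exact: cvg_psum_joint ler01 Hb1 two vC1 le1.
- exact: cvg_psum_joint ler01 Hb2 two vC2 le2.
Qed.

End scaled_laguerre.

Section bessel_zeros.
Variables (R : realType) (alpha : R).
Hypothesis alpha_gt0 : 0 < alpha.
Local Notation b := (bessel_coef alpha).
Local Notation g1 := (psum (pseries_diffs b)).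

Lemma Gamma_rising k :
  alpha * Gamma (k%:R + alpha + 1) =
    \prod_(l < k.+1) (alpha + l%:R) * Gamma (alpha + 1).
Proof.
elim: k => [|k IH]; first by rewrite big_ord1 addr0 add0r.
have -> : k.+1%:R + alpha + 1 = (k%:R + alpha + 1) + 1 by rewrite -nat1r; ring.
have s1 : 1 < k%:R + alpha + 1 by rewrite ltrDr ltr_wpDl.
rewrite (GammaS s1).
rewrite mulrCA IH [in RHS]big_ord_recr /= -[k.+1%:R]nat1r; ring.
Qed.

Lemma besselJE x : 0 < x ->
  besselJ alpha x = - alpha * (x / 2) `^ alpha / Gamma (alpha + 1) *
    g1 (x ^+ 2 / 4).
Proof.
move=> x0; have x2 : 0 < x / 2 by rewrite divr_gt0.
have G0 : Gamma (alpha + 1) != 0 by rewrite gt_eqF// Gamma_gt0// ltrDr.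
set c := _ / Gamma _.
apply/cvg_lim => //.
rewrite [X in X @ _](_ : _ =
    fun n => c * pseries (pseries_diffs b) (x ^+ 2 / 4) n).
  apply: cvgM; first exact: cvg_cst.
  exact: is_cvg_exp_bounded (exp_bounded_diffs (exp_bounded_bessel alpha_gt0)).
apply/funext => n; rewrite /pseries /series /= mulr_sumr.
apply: eq_bigr => k _.
rewrite powRD; last by rewrite (gt_eqF x2) implybT.
rewrite -natrM powR_mulrn ?(ltW x2)// exprM.
have -> : (x / 2) ^+ 2 = x ^+ 2 / 4 by field.
have /(canRL (mulKf (lt0r_neq0 alpha_gt0))) -> := Gamma_rising k.
rewrite /c /pseries_diffs /bessel_coef factS natrM [(-1) ^+ k.+1]exprS.
have := rising_gt0 alpha_gt0 k.+1; set P := \prod_(l < k.+1) _ => P0.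
have k0 : k`!%:R != 0 :> R by rewrite pnatr_eq0 -lt0n fact_gt0.
have k1 : k.+1%:R != 0 :> R by rewrite pnatr_eq0.
move: (Gamma (alpha + 1)) (k.+1%:R) (k`!%:R) G0 k0 k1 => G K L G0 L0 K0.
move: ((x / 2) `^ alpha) ((x ^+ 2 / 4) ^+ k) ((-1) ^+ k) => u v w.
by field; rewrite G0 L0 K0 !gt_eqF.
Qed.

Lemma besselJ_eq0 x : 0 < x ->
  (besselJ alpha x = 0) <-> (g1 (x ^+ 2 / 4) = 0).
Proof.
move=> x0; rewrite besselJE//; split=> [/eqP|->]; last by rewrite mulr0.
have G0 : Gamma (alpha + 1) != 0 by rewrite gt_eqF// Gamma_gt0// ltrDr.
have p0 : (x / 2) `^ alpha != 0 by rewrite gt_eqF// powR_gt0// divr_gt0.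
rewrite mulf_eq0 mulf_eq0 invr_eq0 (negbTE G0) mulf_eq0 (negbTE p0).
by rewrite oppr_eq0 (gt_eqF alpha_gt0) => /eqP.
Qed.

End bessel_zeros.

Section rescaled_xlaguerre.
Variables (R : realType) (alpha : R) (m : nat).
Hypothesis alpha_gt0 : 0 < alpha.
Local Notation b := (bessel_coef alpha).
Local Notation A := (xi_poly (alpha - 1 + 1) m).
Local Notation B := (xi_poly (alpha - 1) m).
Local Notation G := (scaled_laguerre alpha).

Definition rescaled_xlaguerre (j : nat) : {poly R} :=
  let q := j%:R^-1 *: 'X in
  j%:R^-1 *: ((A \Po q) * G j) - (B \Po q) * (G j)^`().
Local Notation F := rescaled_xlaguerre.

Lemma xlaguerreI_rescaled (j : nat) : (0 < j)%N ->
  xlaguerreI alpha m j \Po (j%:R^-1 *: 'X) =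
    (j%:R * gbinomial (j%:R + (alpha - 1)) j) *: F j.
Proof.
move=> j0; have jR : j%:R != 0 :> R by rewrite pnatr_eq0 -lt0n.
rewrite /xlaguerreI /opAI /F; set q := _ *: 'X; set c := gbinomial _ _.
have E := laguerre_scaled alpha_gt0 j0; rewrite -/q -/c in E.
have dE : (laguerre (alpha - 1) j)^`() \Po q = (j%:R * c) *: (G j)^`().
  have := congr1 (fun p => j%:R *: p^`()) E.
  rewrite deriv_comp /q !derivZ derivX -/q scalerA => <-.
  by rewrite alg_polyC mulrC mul_polyC scalerA divff// scale1r.
rewrite rmorphN rmorphB !rmorphM /= E dE opprB scalerBr !scalerA.
rewrite -[j%:R * c * _]mulrAC mulfV// mul1r.
by rewrite -!scalerAr.
Qed.

Lemma xi_poly_at0_gt0 : 0 < B.[0].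
Proof.
rewrite /xi_poly horner_comp hornerN hornerX oppr0 /laguerre horner_sum.
rewrite big_ord_recl big1 ?addr0 => [|k _]; last first.
  by rewrite hornerZ horner_exp hornerN hornerX oppr0 expr0n mulr0.
rewrite hornerZ expr0 hornerC mulr1 subn0 fact0 divr1.
have := gbinomial_rising alpha (leq0n m); rewrite subn0 => ->.
rewrite divr_gt0 ?ltr0n ?fact_gt0// big_mkord.
exact: rising_gt0.
Qed.

Let cvg_comp_scaled (p : {poly R}) (y : R) :
  (fun u : nat * R => (p \Po (u.1%:R^-1 *: 'X)).[u.2])
    @ filter_prod \oo (nbhs y) --> p.[0].
Proof.
have -> : (fun u : nat * R => (p \Po (u.1%:R^-1 *: 'X)).[u.2]) =
    (horner p) \o (fun u => u.1%:R^-1 * u.2).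
  by apply/funext => u; rewrite horner_comp hornerZ hornerX.
have c0 : (fun u : nat * R => u.1%:R^-1 * u.2) @ filter_prod \oo (nbhs y)
    --> (0 : R).
  rewrite -[X in _ --> X](mul0r y).
  by apply: cvgM; [exact: cvg_inv_fst|exact: cvg_snd].
apply: cvg_comp c0 _.
exact: continuous_horner.
Qed.

Lemma cvg_rescaled_xlaguerre (y : R) :
  (fun p : nat * R => (F p.1).[p.2]) @ filter_prod \oo (nbhs y) -->
    - B.[0] * psum (pseries_diffs b) y.
Proof.
have [g0 g1 _] := cvg_scaled_laguerre alpha_gt0 y.
have -> : (fun p : nat * R => (F p.1).[p.2]) = (fun p =>
    p.1%:R^-1 * ((A \Po (p.1%:R^-1 *: 'X)).[p.2] * (G p.1).[p.2]) -
    (B \Po (p.1%:R^-1 *: 'X)).[p.2] * (G p.1)^`().[p.2]).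
  by apply/funext => p; rewrite /F hornerD hornerN hornerZ !hornerM.
rewrite (_ : - B.[0] * psum (pseries_diffs b) y =
  0 * (A.[0] * psum b y) - B.[0] * psum (pseries_diffs b) y); last first.
  by rewrite mul0r add0r mulNr.
apply: cvgB; last by apply: cvgM => //; exact: cvg_comp_scaled.
apply: cvgM; first exact: cvg_inv_fst.
by apply: cvgM => //; exact: cvg_comp_scaled.
Qed.

Lemma cvg_deriv_rescaled_xlaguerre (y : R) :
  (fun p : nat * R => (F p.1)^`().[p.2]) @ filter_prod \oo (nbhs y) -->
    - B.[0] * psum (pseries_diffs (pseries_diffs b)) y.
Proof.
have [g0 g1 g2] := cvg_scaled_laguerre alpha_gt0 y.
have dcomp (p : {poly R}) (c x : R) :
    (p \Po (c *: 'X))^`().[x] = (p^`() \Po (c *: 'X)).[x] * c.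
  by rewrite deriv_comp derivZ derivX hornerM alg_polyC hornerC.
have -> : (fun p : nat * R => (F p.1)^`().[p.2]) = (fun p =>
    p.1%:R^-1 *
      ((A^`() \Po (p.1%:R^-1 *: 'X)).[p.2] * p.1%:R^-1 * (G p.1).[p.2] +
       (A \Po (p.1%:R^-1 *: 'X)).[p.2] * (G p.1)^`().[p.2]) -
    ((B^`() \Po (p.1%:R^-1 *: 'X)).[p.2] * p.1%:R^-1 * (G p.1)^`().[p.2] +
     (B \Po (p.1%:R^-1 *: 'X)).[p.2] * (G p.1)^`()^`().[p.2])).
  apply/funext => p; rewrite /F derivB derivZ !derivM.
  by rewrite hornerD hornerN hornerZ !hornerD !hornerM !dcomp.
set g := psum _ _ in g0; set g' := psum _ _ in g1; set g'' := psum _ _ in g2 *.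
rewrite (_ : - B.[0] * g'' =
  0 * (A^`().[0] * 0 * g + A.[0] * g') -
  (B^`().[0] * 0 * g' + B.[0] * g'')); last by ring.
have inv := @cvg_inv_fst R y.
have Bc p := @cvg_comp_scaled p y.
apply: cvgB.
  apply: cvgM => //; apply: cvgD; last exact: cvgM.
  by apply: cvgM => //; exact: cvgM.
apply: cvgD; last exact: cvgM.
by apply: cvgM => //; exact: cvgM.
Qed.

End rescaled_xlaguerre.

Lemma sorted_regular_zeros (R : realType) (alpha : R) (m j : nat) :
  sorted <%R (regular_zeros alpha m j).
Proof. by apply: sorted_filter; [exact: lt_trans|exact: sorted_roots]. Qed.

Lemma mem_regular_zeros (R : realType) (alpha : R) (m j : nat) (x : R) :
  xlaguerreI alpha m j != 0 ->
  (x \in regular_zeros alpha m j) = (0 <= x) && root (xlaguerreI alpha m j) x.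
Proof.
move=> p0; rewrite mem_filter; congr andb.
by rewrite -roots_on_rootsR.
Qed.

(* Zeros are counted from 0: z i is the (i+1)-st positive zero of J_alpha, and
   nth 0 (regular_zeros alpha m j) i is the (i+1)-st regular zero as soon as
   i < j; the default value 0 at j <= i is irrelevant to the limit. *)
Theorem corollary3p1 (R : realType) (alpha : R) (m : nat) (z : nat -> R)
    (alpha_gt0 : 0 < alpha)
    (z_zeros : increasing_enumeration
       [set x : R | 0 < x /\ besselJ alpha x = 0] z)
    (i : nat) :
  (fun j : nat => j%:R * nth 0 (regular_zeros alpha m j) i) @ \oo
    --> (z i) ^+ 2 / 4.
Proof.
have [z_mono z_range] := z_zeros.
pose s j := [seq j%:R * t | t <- regular_zeros alpha m j].
have -> : (fun j : nat => j%:R * nth 0 (regular_zeros alpha m j) i) =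
    (fun j => nth 0 (s j) i).
  apply/funext => j; have [ij|ji] := ltnP i (size (regular_zeros alpha m j)).
    by rewrite (nth_map 0).
  by rewrite !nth_default ?size_map// mulr0.
have zP k : 0 < z k /\ besselJ alpha (z k) = 0.
  by have : range z (z k) by [exists k]; rewrite z_range.
set b0 := (xi_poly (alpha - 1) m).[0].
have b0_gt0 : 0 < b0 by exact: xi_poly_at0_gt0.
pose b := bessel_coef alpha; pose F := rescaled_xlaguerre alpha m.
pose f y := - b0 * psum (pseries_diffs b) y.
pose f1 y := - b0 * psum (pseries_diffs (pseries_diffs b)) y.
have f_eq0 y : (f y = 0) <-> (psum (pseries_diffs b) y = 0).
  split=> [/eqP|g0]; last by rewrite /f g0 mulr0.
  by rewrite mulf_eq0 oppr_eq0 gt_eqF// => /eqP.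
have f0 : f 0 != 0.
  apply/eqP => /f_eq0; rewrite psum0 /pseries_diffs mul1r.
  have := bessel_coefS alpha_gt0 0; rewrite mulr0n add0r mul1r -/b => E b1.
  move: E; rewrite b1 mulr0 /b /bessel_coef big_ord0 fact0 mulr1 divr1 => /eqP.
  by rewrite eq_sym oppr_eq0 oner_eq0.
have Ff y : (fun p : nat * R => (F p.1).[p.2]) @ filter_prod \oo (nbhs y)
    --> f y by exact: cvg_rescaled_xlaguerre.
have w_gt0 k : 0 < z k ^+ 2 / 4 by rewrite divr_gt0// exprn_gt0// (zP k).1.
have fw k : f (z k ^+ 2 / 4) = 0.
  by apply/f_eq0/besselJ_eq0 => //; [exact: (zP k).1|exact: (zP k).2].
apply: (@cvg_nth_zeros R F f f1 s (fun k => z k ^+ 2 / 4)) => //.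
- by move=> y _; exact: cvg_deriv_rescaled_xlaguerre.
- have F0 : \forall j \near \oo, forall y, 0 <= y <= 0 -> (F j).[y] != 0.
    apply: (@eventually_no_zero _ F f) => // y.
    by rewrite -eq_le => /eqP <-.
  near=> j; have j0 : (0 < j)%N by near: j; exact: nbhs_infty_gt.
  have jR : 0 < j%:R :> R by rewrite ltr0n.
  have Fj0 : (F j).[0] != 0 by apply: (near F0 j) => //; rewrite lexx.
  pose c := j%:R * gbinomial (j%:R + (alpha - 1)) j.
  have PF x : (xlaguerreI alpha m j).[x / j%:R] = c * (F j).[x].
    rewrite -hornerZ -xlaguerreI_rescaled// horner_comp.
    by rewrite hornerZ hornerX mulrC.
  have c0 : c != 0.
    rewrite mulf_neq0 ?gt_eqF//.
    have := gbinomial_rising alpha (leq0n j); rewrite subn0 => ->.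
    by rewrite divr_gt0 ?ltr0n ?fact_gt0// big_mkord rising_gt0.
  have P0 : xlaguerreI alpha m j != 0.
    apply/eqP => P0; have := PF 0; rewrite P0 horner0 => /esym/eqP.
    by rewrite mulf_eq0 (negbTE c0) (negbTE Fj0).
  split.
    apply: (@homo_sorted _ _ ( *%R j%:R) <%R) (sorted_regular_zeros _ _ _).
    by move=> x y; rewrite ltr_pM2l.
  move=> x; rewrite -[in LHS](mulfVK (lt0r_neq0 jR) x) mulrC.
  rewrite mem_map; last exact: mulfI (lt0r_neq0 jR).
  rewrite mem_regular_zeros// pmulr_lge0 ?invr_gt0//; congr andb.
  by rewrite !rootE PF mulf_eq0 (negbTE c0).
- move=> k l kl; rewrite ltr_pM2r ?invr_gt0//.
  by rewrite ltrXn2r// ?nnegrE ?ltW ?(zP _).1// z_mono.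
- move=> y y0 /f_eq0 gy; pose x := 2 * Num.sqrt y.
  have x0 : 0 < x by rewrite mulr_gt0// sqrtr_gt0.
  have xy : x ^+ 2 / 4 = y by rewrite /x exprMn sqr_sqrtr ?ltW//; field.
  have : range z x.
    by rewrite z_range; split=> //; apply/besselJ_eq0; rewrite ?xy.
  by case=> k _ zk; exists k; rewrite zk xy.
- move=> k; rewrite /f1 mulf_neq0 ?oppr_eq0 ?(gt_eqF b0_gt0)//.
  by apply: bessel_simple_zero => //; apply/f_eq0.
Unshelve. all: by end_near. Qed.
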